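(* Every 5-edge-connected graph with at most five 5-edge-cuts is $Z_3$-connected.
   Context: Graphs are finite and loopless, but may have multiple edges. A graph $G$ is $k$-edge-connected if $G-S$ is connected for each edge set $S$ with $|S|<k$. For $X\subset V(G)$, $\partial_G(X)$ denotes the set of edges of $G$ with one end in $X$ and the other in $V(G)\setminus X$; an edge set of the form $C=\partial_G(X)$ is a $k$-edge-cut if $|C|=k$. Edge-cuts are counted as edge sets. For an orientation $D$ of $E(G)$ and a vertex $v$, $\partial_D^+(v)$ (resp. $\partial_D^-(v)$) is the set of arcs with tail (resp. head) $v$. $Z_3$ denotes the integers modulo 3. A mapping $\beta:V(G)\to Z_3$ is a $Z_3$-boundary of $G$ if $\sum_{v\in V(G)}\beta(v)\equiv 0\pmod 3$. A graph $G$ is $Z_3$-connected if for every $Z_3$-boundary $\beta$ of $G$ there are an orientation $D$ of $E(G)$ and a function $f:E(G)\to Z_3\setminus\{0\}$ such that $\sum_{e\in\partial_D^+(v)}f(e)-\sum_{e\in\partial_D^-(v)}f(e)\equiv\beta(v)\pmod 3$ for every vertex $v\in V(G)$. *)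

(* Defs.v *)
From HB Require Import structures.
From mathcomp Require Import all_boot all_order all_algebra.

Set Implicit Arguments.
Unset Strict Implicit.
Unset Printing Implicit Defensive.

Import GRing.Theory.
Local Open Scope ring_scope.

(* Distinct edges may have the same pair of ends (multiple edges); having
   exactly two ends excludes loops. *)
Record multigraph : Type := MultiGraph {
  vert : finType;
  edge : finType;
  ends : edge -> {set vert};
  card_ends : forall e : edge, #|ends e| = 2%N
}.

Arguments ends {m} e.

Definition adjacent_avoiding (G : multigraph) (S : {set edge G}) : rel (vert G) :=
  fun x y => [exists e : edge G, (e \notin S) && (ends e == [set x; y])].

(* G - S is connected; the null graph counts as connected. *)
Definition connected_avoiding (G : multigraph) (S : {set edge G}) : Prop :=
  forall x y : vert G, connect (adjacent_avoiding S) x y.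

Definition edge_connected (k : nat) (G : multigraph) : Prop :=
  forall S : {set edge G}, (#|S| < k)%N -> connected_avoiding S.

Definition edge_boundary (G : multigraph) (X : {set vert G}) : {set edge G} :=
  [set e | [exists x in X, exists y in ~: X, ends e == [set x; y]]].

(* A set of edge sets: X and its complement contribute a single cut. *)
Definition edge_cuts (k : nat) (G : multigraph) : {set {set edge G}} :=
  [set C : {set edge G} | (#|C| == k) && [exists X : {set vert G}, C == edge_boundary X]].

Record orientation (G : multigraph) : Type := Orientation {
  tail : edge G -> vert G;
  head : edge G -> vert G;
  ends_orientation : forall e : edge G, ends e = [set tail e; head e]
}.

Definition out_arcs (G : multigraph) (D : orientation G) (v : vert G) :
  {set edge G} := [set e | tail D e == v].

Definition in_arcs (G : multigraph) (D : orientation G) (v : vert G) :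
  {set edge G} := [set e | head D e == v].

Definition Z3_boundary (G : multigraph) (beta : vert G -> 'Z_3) : Prop :=
  \sum_(v : vert G) beta v = 0.

Definition Z3_connected (G : multigraph) : Prop :=
  forall beta : vert G -> 'Z_3, Z3_boundary beta ->
  exists (D : orientation G) (f : edge G -> 'Z_3),
    (forall e : edge G, f e != 0) /\
    (forall v : vert G,
       \sum_(e in out_arcs D v) f e - \sum_(e in in_arcs D v) f e = beta v).

(* Main.v *)
Require Import Defs.
From mathcomp Require Import all_boot all_order all_algebra.
From mathcomp Require Import zify.

Set Implicit Arguments.
Unset Strict Implicit.
Unset Printing Implicit Defensive.

Import Order.TTheory GRing.Theory Num.Theory.
Local Open Scope ring_scope.

(** The proof follows the induction of Lovász, Thomassen, Wu and Zhang for
    6-edge-connected graphs, set up so that cuts of size 4 and 5 are allowed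
    when the prescribed boundary is compatible with them.

    Fix a vertex set U together with one further vertex, the outer vertex,
    whose incident edges are already oriented: p x of them enter x in U and
    q x leave x. The remaining edges have to be oriented so that the net
    outflow of each x in U is S x modulo 3. For a subset A of U let deg A be
    the number of edges, those at the outer vertex included, leaving A, let
    bnd A be the boundary that A must receive when those edges are counted,
    and let tau be the integer of least absolute value with tau = bnd A mod 3
    and tau = deg A mod 2, so that |tau| <= 3. The hypothesis, called valid, is
    deg A >= 4 + |tau| for every nonempty proper subset A of U (the predicate
    good) and deg U <= 4 + |tau| for the outer vertex (the predicate small).
    The theorem valid_solvable says that this suffices. A set is not small
    exactly when deg A >= 6 + |tau|, by parity.

    Why valid_solvable holds. If some proper A with at least two vertices is
    small, contract A, solve, and then solve inside A with everything outside A
    as the new outer vertex (small_set_solvable). Otherwise every nontrivial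
    set has slack 2 and only single vertices have to be watched. A vertex with
    deg = 4 and bnd = 0 is removed by splitting off its edges in two pairs
    (remove_vertex_solvable). Every other vertex tolerates the deletion of an
    arc leaving it or of an arc entering it, or both; an edge xy such that x
    tolerates x -> y and y tolerates it too is oriented and deleted
    (delete_arc_solvable). When there is no such edge, connectedness forces all
    vertices to tolerate only, say, leaving arcs. Then arcs into the outer
    vertex can be dropped, and at most five arcs, all out of it, are left.
    Since -1 = 2 modulo 3, an arc from the outer vertex to x may be replaced by
    two arcs from x to it; after this x tolerates an entering arc, so that an
    edge at x can be deleted (all_out_solvable).

    Deriving the theorem. Only 5-edge-cuts can violate the hypothesis. Any two
    nontrivial vertex bipartitions are separated by a common pair of vertices,
    and one further vertex per bipartition takes care of the others, so at most
    five vertices meet both sides of all 5-edge-cuts (exists_cut_separator).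
    An outer vertex sending one arc to each of them raises both sides of every
    5-edge-cut to degree at least 6, and its own degree is at most 5, which is
    always small. *)

(** * Boundaries, degrees and orientations *)

(** This is d >= 4 + |tau|, where tau is the integer in [-3, 3] congruent to b
    modulo 3 and to d modulo 2. *)
Definition good (d : nat) (b : int) : bool :=
  [|| (5 < d)%N, (d == 5%N) && ~~ (3 %| b)%Z | (d == 4%N) && (3 %| b)%Z].

(** This is d <= 4 + |tau| for the same tau. *)
Definition small (d : nat) (b : int) : bool :=
  [|| (d < 6)%N, (d == 6%N) && ~~ (3 %| b)%Z | (d == 7%N) && (3 %| b)%Z].

Section Extension.

Variables E V : finType.

(** The stored direction of an arc is only a reference for the booleans that
    encode orientations. Loops are allowed because contraction creates them;
    they contribute neither to cuts nor to flows. The vertex type stays fixed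
    throughout, and the current vertex set is a subset U of it. *)
Record digraph := Digraph {arcs : {set E}; src : E -> V; tgt : E -> V}.

Implicit Types (g : digraph) (A B U : {set V}) (S : V -> int) (p q : V -> nat).
Implicit Types (o : E -> bool) (x y : V).

Definition arc_tail g o e := if o e then src g e else tgt g e.
Definition arc_head g o e := if o e then tgt g e else src g e.

Definition flux g o A : int :=
  \sum_(e in arcs g) ((arc_tail g o e \in A)%:Z - (arc_head g o e \in A)%:Z).

Definition solvable g U S : Prop :=
  exists o, forall x, x \in U -> (3 %| flux g o [set x] - S x)%Z.

Definition crosses g A e : bool := (src g e \in A) (+) (tgt g e \in A).

Definition cut g A : nat := \sum_(e in arcs g) crosses g A e.

Definition weight p A : nat := \sum_(x in A) p x.

Definition demand S A : int := \sum_(x in A) S x.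

(** The function p counts the arcs from the outer vertex, q those to it, while S
    is the demand on the arcs of g alone; hence the demand with the outer arcs
    included is S - p + q. *)
Definition deg g p q A : nat := (cut g A + weight p A + weight q A)%N.

Definition bnd S p q A : int := demand S A - (weight p A)%:Z + (weight q A)%:Z.

Definition arcs_within g U : Prop :=
  forall e, e \in arcs g -> src g e != tgt g e ->
    (src g e \in U) && (tgt g e \in U).

(** As no arc of g leaves U, the last condition is the degree condition on the
    outer vertex. *)
Definition valid g U S p q : Prop :=
  [/\ arcs_within g U,
      (3 %| demand S U)%Z,
      forall A, A != set0 -> A \proper U -> good (deg g p q A) (bnd S p q A)
    & small (deg g p q U) (bnd S p q U)].

Definition smaller_solvable n : Prop :=
  forall g U S p q, (#|U| + #|arcs g| < n)%N -> valid g U S p q ->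
    solvable g U S.

Definition no_small_set g U S p q : Prop :=
  forall A, A \proper U -> (1 < #|A|)%N -> ~~ small (deg g p q A) (bnd S p q A).

(** * Contraction of a small set *)

Lemma cut_full g U : arcs_within g U -> cut g U = 0%N.
Proof.
move=> gU; apply: big1 => e eg; rewrite /crosses.
have [->|ne] := eqVneq (src g e) (tgt g e); first by rewrite addbb.
by have /andP[-> ->] := gU e eg ne.
Qed.

Lemma sum_set1 A (x : V) : (\sum_(z in A) (z == x))%N = (x \in A).
Proof.
rewrite (bigID (pred1 x)) /= [X in (_ + X)%N]big1 ?addn0; last first.
  by move=> z /andP[_ /negPf ->].
have [xA|xA] := boolP (x \in A).
  by rewrite (bigD1 x) ?xA ?eqxx //= big1 ?addn0 // => z /andP[/andP[_ ->]].
by rewrite big1 // => z /andP[zA /eqP zx]; rewrite -zx zA in xA.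
Qed.

Lemma sum_set1Z A (x : V) : \sum_(z in A) (z == x)%:Z = (x \in A)%:Z.
Proof. by rewrite -sum_set1 (big_morph Posz PoszD (erefl _)). Qed.

Lemma sum_fiber (R : nmodType) (f : V -> V) (F : V -> R) B :
  \sum_(x in B) \sum_(z | f z == x) F z = \sum_(z in f @^-1: B) F z.
Proof.
rewrite [RHS](partition_big f (mem B)) /=; last by move=> z; rewrite inE.
apply: eq_bigr => x xB; apply: eq_bigl => z; rewrite inE.
by case: eqP => [->|_]; rewrite ?xB ?andbF.
Qed.

Definition map_ends (f : V -> V) g :=
  Digraph (arcs g) (f \o src g) (f \o tgt g).

Definition fiber_sum (R : nmodType) (f : V -> V) (F : V -> R) x :=
  \sum_(z | f z == x) F z.

Lemma flux_map f g o B : flux (map_ends f g) o B = flux g o (f @^-1: B).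
Proof.
apply: eq_bigr => e _; rewrite !inE /arc_tail /arc_head /=.
by case: (o e).
Qed.

Lemma cut_map f g B : cut (map_ends f g) B = cut g (f @^-1: B).
Proof. by apply: eq_bigr => e _; rewrite /crosses !inE. Qed.

Lemma weight_fiber f p B : weight (fiber_sum f p) B = weight p (f @^-1: B).
Proof. exact: sum_fiber. Qed.

Lemma demand_fiber f S B : demand (fiber_sum f S) B = demand S (f @^-1: B).
Proof. exact: sum_fiber. Qed.

Lemma deg_map f g p q B :
  deg (map_ends f g) (fiber_sum f p) (fiber_sum f q) B = deg g p q (f @^-1: B).
Proof. by rewrite /deg cut_map !weight_fiber. Qed.

Lemma bnd_map f S p q B :
  bnd (fiber_sum f S) (fiber_sum f p) (fiber_sum f q) B
  = bnd S p q (f @^-1: B).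
Proof. by rewrite /bnd demand_fiber !weight_fiber. Qed.

Definition contraction A (a : V) z := if z \in A then a else z.

(** The graph in which A is contracted to a is valid because its cuts are
    exactly the cuts of g that do not split A. *)
Lemma contraction_solvable g U A (a : V) S p q :
  valid g U S p q -> A \proper U -> (1 < #|A|)%N -> a \in A ->
  smaller_solvable (#|U| + #|arcs g|) ->
  exists o, (3 %| flux g o A - demand S A)%Z /\
    forall x, x \in U :\: A -> (3 %| flux g o [set x] - S x)%Z.
Proof.
move=> [gU SU gd sm] AU A1 aA IH.
have sAU := proper_sub AU.
have aU : a \in U by apply: (subsetP sAU).
pose f := contraction A a; pose U1 := a |: (U :\: A).
have fU1 : f @^-1: U1 = U.
  apply/setP => z; rewrite !inE /f /contraction.
  case: ifP => zA; first by rewrite eqxx (subsetP sAU _ zA).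
  by rewrite zA /=; case: eqP => // za; rewrite za aA in zA.
have fa : f @^-1: [set a] = A.
  apply/setP => z; rewrite !inE /f /contraction.
  by case: ifP => zA; rewrite ?eqxx //; case: eqP => // za; rewrite za aA in zA.
have fx x : x \in U :\: A -> f @^-1: [set x] = [set x].
  rewrite inE => /andP[xA _]; apply/setP => z; rewrite !inE /f /contraction.
  case: ifP => // zA.
  have -> : (a == x) = false by apply/eqP => ax; rewrite -ax aA in xA.
  by apply/esym/eqP => zx; rewrite -zx zA in xA.
have card_U1 : (#|U1| < #|U|)%N.
  rewrite cardsU1 !inE aA /= cardsD (setIidPr sAU).
  by have := subset_leq_card sAU; lia.
have [||o ho] := IH (map_ends f g) U1 (fiber_sum f S)
  (fiber_sum f p) (fiber_sum f q).
- by rewrite ltn_add2r.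
- split.
  + move=> e eg ne /=; have ne' : src g e != tgt g e.
      by apply: contraNneq ne => /= ->.
    have /andP[sU tU] := gU e eg ne'.
    have h z : z \in U -> f z \in U1 by rewrite -{1}fU1 inE.
    by rewrite !h.
  + by rewrite demand_fiber fU1.
  + move=> B B0 BU1; rewrite deg_map bnd_map; apply: gd.
      have [x xB] := set0Pn _ B0; apply/set0Pn.
      have /setU1P[xa|/setDP[xU xA]] := subsetP (proper_sub BU1) _ xB.
        by exists a; rewrite inE /f /contraction aA -xa.
      by exists x; rewrite inE /f /contraction (negPf xA).
    have [sB [x xU1 xB]] := properP BU1.
    apply/properP; split; first by rewrite -fU1 preimsetS.
    have /setU1P[xa|/setDP[xU xA]] := xU1.
      by exists a; rewrite // inE /f /contraction aA -xa.
    by exists x; rewrite // inE /f /contraction (negPf xA).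
  + by rewrite deg_map bnd_map fU1.
exists o; split.
  have := ho a; rewrite flux_map fa; rewrite !inE eqxx /= => /(_ isT).
  by rewrite -[in demand _ _]fa -demand_fiber /demand big_set1.
move=> x xUA; have := ho x; rewrite flux_map fx //.
rewrite inE xUA orbT => /(_ isT).
suff -> : fiber_sum f S x = S x by [].
have -> : fiber_sum f S x = demand (fiber_sum f S) [set x].
  by rewrite /demand big_set1.
by rewrite demand_fiber fx // /demand big_set1.
Qed.

Definition restrict g A :=
  Digraph [set e in arcs g | (src g e \in A) && (tgt g e \in A)]
    (src g) (tgt g).

Definition out_cross g o A x : nat :=
  \sum_(e in arcs g) (crosses g A e && (arc_tail g o e == x)).

Definition in_cross g o A x : nat :=
  \sum_(e in arcs g) (crosses g A e && (arc_head g o e == x)).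

Lemma arc_tailE g o e B :
  (arc_tail g o e \in B) = if o e then src g e \in B else tgt g e \in B.
Proof. by rewrite /arc_tail; case: (o e). Qed.

Lemma arc_headE g o e B :
  (arc_head g o e \in B) = if o e then tgt g e \in B else src g e \in B.
Proof. by rewrite /arc_head; case: (o e). Qed.

Lemma sum_out_cross g o A B :
  (\sum_(x in B) out_cross g o A x
   = \sum_(e in arcs g) (crosses g A e && (arc_tail g o e \in B)))%N.
Proof.
rewrite exchange_big; apply: eq_bigr => e _ /=.
case: (crosses g A e) => /=; last by rewrite big1.
by rewrite -sum_set1; apply: eq_bigr => x _; rewrite eq_sym.
Qed.

Lemma sum_in_cross g o A B :
  (\sum_(x in B) in_cross g o A x
   = \sum_(e in arcs g) (crosses g A e && (arc_head g o e \in B)))%N.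
Proof.
rewrite exchange_big; apply: eq_bigr => e _ /=.
case: (crosses g A e) => /=; last by rewrite big1.
by rewrite -sum_set1; apply: eq_bigr => x _; rewrite eq_sym.
Qed.

(** Seen from inside A, the arcs crossing the boundary of A, once oriented, are
    arcs at an outer vertex; degrees of subsets of A do not change. *)
Lemma cut_restrict g o A B : B \subset A ->
  cut g B = (cut (restrict g A) B
    + weight (in_cross g o A) B + weight (out_cross g o A) B)%N.
Proof.
move=> BA; rewrite /weight sum_out_cross sum_in_cross /cut.
rewrite [X in (X + _ + _)%N](eq_bigl
  [pred e in arcs g | (src g e \in A) && (tgt g e \in A)]); last first.
  by move=> e; rewrite !inE.
rewrite big_mkcondr -!big_split; apply: eq_bigr => e _ /=.
rewrite /crosses /arc_tail /arc_head /=.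
have := subsetP BA (src g e); have := subsetP BA (tgt g e).
case: (o e); case: (src g e \in A); case: (src g e \in B);
  case: (tgt g e \in A); case: (tgt g e \in B); move=> //= h1 h2;
  by [have := h1 isT | have := h2 isT].
Qed.

Lemma flux_restrict g o1 o2 A x : x \in A ->
  flux g (fun e => if (src g e \in A) && (tgt g e \in A) then o2 e else o1 e)
    [set x]
  = flux (restrict g A) o2 [set x]
    + ((out_cross g o1 A x)%:Z - (in_cross g o1 A x)%:Z).
Proof.
move=> xA; rewrite /flux [X in X + _](eq_bigl
  [pred e in arcs g | (src g e \in A) && (tgt g e \in A)]); last first.
  by move=> e; rewrite !inE.
rewrite /out_cross /in_cross !(big_morph Posz PoszD (erefl _)) -sumrN -big_split.
rewrite big_mkcondr -big_split; apply: eq_bigr => e _ /=.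
rewrite /crosses -!in_set1 !arc_tailE !arc_headE /=.
have xA1 : [set x] \subset A by rewrite sub1set.
have := subsetP xA1 (src g e); have := subsetP xA1 (tgt g e).
case: (o1 e); case: (o2 e); case: (src g e \in A); case: (src g e \in [set x]);
  case: (tgt g e \in A); case: (tgt g e \in [set x]); move=> //= h1 h2;
  by [have := h1 isT | have := h2 isT].
Qed.

Lemma flux_out_cross g o A :
  flux g o A = (weight (out_cross g o A) A)%:Z - (weight (in_cross g o A) A)%:Z.
Proof.
rewrite /weight sum_out_cross sum_in_cross !(big_morph Posz PoszD (erefl _)).
rewrite -sumrN -big_split; apply: eq_bigr => e _ /=.
rewrite /crosses /arc_tail /arc_head.
by case: (o e); case: (src g e \in A); case: (tgt g e \in A).
Qed.

(** A small set satisfies the degree condition of an outer vertex, so after the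
    contraction of A has been solved, the rest of the graph can play that role
    for A. *)
Lemma small_set_solvable g U A S p q :
  valid g U S p q -> A \proper U -> (1 < #|A|)%N ->
  small (deg g p q A) (bnd S p q A) ->
  smaller_solvable (#|U| + #|arcs g|) -> solvable g U S.
Proof.
move=> gv AU A1 smA IH; have [gU SU gd sm] := gv.
have sAU := proper_sub AU.
have /card_gt0P[a aA] : (0 < #|A|)%N by apply: leq_trans A1.
have [o1 [ho1A ho1]] := contraction_solvable gv AU A1 aA IH.
pose out := out_cross g o1 A; pose inn := in_cross g o1 A.
pose p2 x := (p x + inn x)%N; pose q2 x := (q x + out x)%N.
pose S2 x : int := S x - (out x)%:Z + (inn x)%:Z.
have totp B : weight p2 B = (weight p B + weight inn B)%N by rewrite -big_split.
have totq B : weight q2 B = (weight q B + weight out B)%N by rewrite -big_split.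
have demS B : demand S2 B = demand S B - (weight out B)%:Z + (weight inn B)%:Z.
  by rewrite /demand /weight !big_split sumrN !(big_morph Posz PoszD (erefl _)).
have degE B : B \subset A -> deg (restrict g A) p2 q2 B = deg g p q B.
  by move=> BA; rewrite /deg (cut_restrict g o1 BA) totp totq /inn /out; lia.
have bndE B : bnd S2 p2 q2 B = bnd S p q B.
  by rewrite /bnd demS totp totq; lia.
have [||o2 ho2] := IH (restrict g A) A S2 p2 q2.
- have := proper_card AU.
  have : (#|arcs (restrict g A)| <= #|arcs g|)%N.
    by apply/subset_leq_card/subsetP => e; rewrite inE => /andP[].
  by lia.
- split.
  + by move=> e; rewrite inE => /andP[].
  + rewrite demS; move: ho1A; rewrite flux_out_cross -/out -/inn; lia.
  + move=> B B0 BA; rewrite degE ?proper_sub // bndE.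
    by apply: gd => //; apply: proper_trans BA AU.
  + by rewrite degE // bndE.
exists (fun e => if (src g e \in A) && (tgt g e \in A) then o2 e else o1 e).
move=> x xU; have [xA|xA] := boolP (x \in A).
  rewrite flux_restrict //; have := ho2 x xA.
  by rewrite /S2 /out /inn; lia.
have := ho1 x; rewrite !inE xA xU => /(_ isT).
congr (dvdz _ (_ - _)); apply: eq_bigr => e _.
rewrite !arc_tailE !arc_headE !inE.
have [/andP[sA tA]|//] := boolP ((src g e \in A) && (tgt g e \in A)).
have -> : (src g e == x) = false by apply: contraNF xA => /eqP <-.
have -> : (tgt g e == x) = false by apply: contraNF xA => /eqP <-.
by case: (o1 e); case: (o2 e).
Qed.

(** * Deletion of an oriented arc *)

Definition joins g x y e : bool :=
  (src g e == x) && (tgt g e == y) || (src g e == y) && (tgt g e == x).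

Lemma joinsC g x y e : joins g x y e = joins g y x e.
Proof. by rewrite /joins orbC. Qed.

Lemma crosses_joins g x y e A :
  joins g x y e -> crosses g A e = (x \in A) (+) (y \in A).
Proof.
by case/orP=> /andP[/eqP sx /eqP tx]; rewrite /crosses sx tx // addbC.
Qed.

Lemma joins_direction g x y e :
  joins g x y e -> exists b : bool,
    (if b then src g e else tgt g e) = x /\
    (if b then tgt g e else src g e) = y.
Proof.
by case/orP=> /andP[/eqP sx /eqP tx]; [exists true | exists false].
Qed.

Lemma joins_within g U x y e :
  arcs_within g U -> e \in arcs g -> joins g x y e -> x != y ->
  x \in U /\ y \in U.
Proof.
move=> gU eg; case/orP=> /andP[/eqP sx /eqP tx] xy; have := gU e eg;
  rewrite sx tx; first by move=> /(_ xy) /andP[].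
by rewrite eq_sym => /(_ xy) /andP[].
Qed.

Lemma weight_set1 p x : weight p [set x] = p x.
Proof. exact: big_set1. Qed.

Lemma demand_set1 S x : demand S [set x] = S x.
Proof. exact: big_set1. Qed.

Lemma weight_setD p U A : A \subset U ->
  weight p U = (weight p A + weight p (U :\: A))%N.
Proof. by move=> AU; rewrite /weight (big_setID A) (setIidPr AU). Qed.

Lemma demand_setD S U A : A \subset U ->
  demand S U = demand S A + demand S (U :\: A).
Proof. by move=> AU; rewrite /demand (big_setID A) (setIidPr AU). Qed.

Lemma bnd_setD S p q U A : A \subset U ->
  bnd S p q U = bnd S p q A + bnd S p q (U :\: A).
Proof.
by move=> AU; rewrite /bnd (demand_setD S AU) !(weight_setD _ AU); clear; lia.
Qed.

Lemma cut_setD g U A :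
  arcs_within g U -> A \subset U -> cut g (U :\: A) = cut g A.
Proof.
move=> gU AU; apply: eq_bigr => e eg; rewrite /crosses !inE.
have [->|ne] := eqVneq (src g e) (tgt g e); first by rewrite !addbb.
have /andP[-> ->] := gU e eg ne; rewrite !andbT.
by case: (_ \in A); case: (_ \in A).
Qed.

Lemma cut_gt0 g x : (0 < cut g [set x])%N ->
  exists e y, [/\ e \in arcs g, joins g x y e & x != y].
Proof.
rewrite lt0n /cut sum_nat_eq0 negb_forall => /existsP[e].
rewrite negb_imply eqb0 negbK /crosses !inE => /andP[eg c].
have [sx|sx] := eqVneq (src g e) x.
  exists e, (tgt g e); split=> //; rewrite /joins ?sx ?eqxx //.
  by move: c; rewrite sx eqxx eq_sym.
exists e, (src g e); split=> //; last by rewrite eq_sym.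
by move: c; rewrite (negPf sx) /joins /= => ->; rewrite eqxx orbT.
Qed.

Definition delete g e := Digraph (arcs g :\ e) (src g) (tgt g).

Lemma cut_delete g x y e A : e \in arcs g -> joins g x y e ->
  cut g A = (cut (delete g e) A + ((x \in A) (+) (y \in A)))%N.
Proof.
move=> eg exy; rewrite /cut (big_setD1 e) //= (crosses_joins _ exy) addnC.
by [].
Qed.

Lemma arcs_within_delete g U e : arcs_within g U -> arcs_within (delete g e) U.
Proof. by move=> gU f; rewrite inE => /andP[_]; apply: gU. Qed.

(** The demand that remains after an arc from x to y has been fixed. *)
Definition shift S x y z : int := S z - (z == x)%:Z + (z == y)%:Z.

Lemma demand_shift S x y A :
  demand (shift S x y) A = demand S A - (x \in A)%:Z + (y \in A)%:Z.
Proof. by rewrite /demand !big_split sumrN !sum_set1Z. Qed.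

Definition raise p x k z : nat := (p z + k * (z == x))%N.

Lemma weight_raise p x k A :
  weight (raise p x k) A = (weight p A + k * (x \in A))%N.
Proof. by rewrite /weight big_split -big_distrr /= sum_set1. Qed.

Definition lower p x z : nat := (p z - (z == x))%N.

Lemma weight_lower p x A : (0 < p x)%N ->
  weight p A = (weight (lower p x) A + (x \in A))%N.
Proof.
move=> px; rewrite -sum_set1 -big_split; apply: eq_bigr => z _ /=.
by rewrite /lower; case: eqP => [->|]; lia.
Qed.

Lemma solvable_delete g U S x y e :
  e \in arcs g -> joins g x y e ->
  solvable (delete g e) U (shift S x y) -> solvable g U S.
Proof.
move=> eg /joins_direction[b [tb hb]] [o ho].
exists (fun f => if f == e then b else o f) => z zU.
have := ho z zU; set fx := flux (delete g e) _ _.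
rewrite /flux (big_setD1 e eg) /= [X in _ -> (_ %| _ + X - _)%Z](_ : _ = fx).
  rewrite /arc_tail /arc_head eqxx tb hb /shift !inE (eq_sym x) (eq_sym y).
  by lia.
by apply: eq_bigr => f; rewrite !inE /arc_tail /arc_head => /andP[/negPf ->].
Qed.

(** These test whether a set of degree d and boundary b stays good when an arc
    leaving it, respectively entering it, is fixed and deleted. *)
Definition out_ok d b := good d.-1 (b - 1).
Definition in_ok d b := good d.-1 (b + 1).

(** A set with slack has degree at least 6, and boundary 0 if the degree is 6;
    so a drop of the degree to 5 is harmless when the boundary changes too. *)
Lemma good_delete d b d' b' :
  ~~ small d b -> (d <= d')%N \/ d = d'.+1 /\ ~~ (3 %| b' - b)%Z ->
  good d' b'.
Proof. by rewrite /small /good; lia. Qed.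

Lemma proper_set1_or_large A U : A != set0 -> A \proper U ->
  (exists2 z, z \in U & A = [set z]) \/ (1 < #|A|)%N.
Proof.
move=> A0 AU; have [/cards1P[z Az]|A1] := boolP (#|A| == 1%N).
  by left; exists z => //; apply: (subsetP (proper_sub AU)); rewrite Az set11.
by right; move: A1; rewrite -card_gt0 in A0; lia.
Qed.

Lemma set1_proper U x : x \in U -> (1 < #|U|)%N -> [set x] \proper U.
Proof.
by move=> xU U1; rewrite properEcard sub1set xU cards1.
Qed.

Lemma delete_arc_solvable g U S p q x y e :
  valid g U S p q -> no_small_set g U S p q ->
  e \in arcs g -> joins g x y e -> x != y ->
  out_ok (deg g p q [set x]) (bnd S p q [set x]) ->
  in_ok (deg g p q [set y]) (bnd S p q [set y]) ->
  smaller_solvable (#|U| + #|arcs g|) -> solvable g U S.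
Proof.
move=> [gU SU gd sm] ns eg exy xy xo yi IH.
have [xU yU] := joins_within gU eg exy xy.
apply: (solvable_delete eg exy); apply: (IH _ _ _ p q).
  by rewrite /= [in leqRHS](cardsD1 e) eg; lia.
have cutE A := cut_delete A eg exy.
split.
- exact: arcs_within_delete.
- by rewrite demand_shift xU yU; move: SU; lia.
- move=> A A0 AU; have := gd A A0 AU; have := cutE A.
  rewrite /deg /bnd demand_shift.
  have [[z zU Az]|A1] := proper_set1_or_large A0 AU; last first.
    move=> dE _; apply: (good_delete (ns A AU A1)); rewrite /deg /bnd dE.
    by case: (x \in A); case: (y \in A) => /=; clear; lia.
  move: xo yi; rewrite /out_ok /in_ok /deg /bnd Az !inE.
  have [<-|xz] := eqVneq x z.
    rewrite eq_sym (negPf xy) /good /= (cutE [set x]) !inE eqxx eq_sym.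
    by rewrite (negPf xy) /=; clear; lia.
  have [<-|yz] := eqVneq y z.
    by rewrite /good /= (cutE [set y]) !inE eqxx (negPf xy) /=; clear; lia.
  clear; by rewrite /good /=; lia.
- move: sm; rewrite /deg /bnd demand_shift (cutE U) xU yU /=.
  rewrite /small; clear; lia.
Qed.

(** * Splitting off a vertex of degree four *)

Definition lift_pair g e1 e2 y1 y2 :=
  Digraph (arcs g :\ e2) (fun e => if e == e1 then y1 else src g e)
    (fun e => if e == e1 then y2 else tgt g e).

Lemma cut_lift_pair g e1 e2 x y1 y2 A :
  e1 \in arcs g -> e2 \in arcs g -> e1 != e2 ->
  joins g x y1 e1 -> joins g x y2 e2 ->
  (cut g A + ((y1 \in A) (+) (y2 \in A))
   = cut (lift_pair g e1 e2 y1 y2) A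
     + ((x \in A) (+) (y1 \in A)) + ((x \in A) (+) (y2 \in A)))%N.
Proof.
move=> e1g e2g ne j1 j2; have e1g' : e1 \in arcs g :\ e2 by rewrite !inE ne.
rewrite /cut (big_setD1 e2 e2g) /= !(big_setD1 e1 e1g') /=.
rewrite (crosses_joins _ j1) (crosses_joins _ j2).
have -> : crosses (lift_pair g e1 e2 y1 y2) A e1 = (y1 \in A) (+) (y2 \in A).
  by rewrite /crosses /= eqxx.
rewrite [in X in _ = X](eq_bigr (fun e => crosses g A e : nat)); first by lia.
by move=> e; rewrite !inE /crosses /= => /andP[/negPf ->].
Qed.

Lemma solvable_lift_pair g U S e1 e2 x y1 y2 :
  e1 \in arcs g -> e2 \in arcs g -> e1 != e2 ->
  joins g x y1 e1 -> joins g x y2 e2 ->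
  solvable (lift_pair g e1 e2 y1 y2) U S -> solvable g U S.
Proof.
move=> e1g e2g ne /joins_direction[b1 [t1 h1]] /joins_direction[b2 [t2 h2]] [o ho].
have e1g' : e1 \in arcs g :\ e2 by rewrite !inE ne.
exists (fun f => if f == e1 then b1 (+) o e1
                 else if f == e2 then b2 (+) ~~ o e1 else o f) => z zU.
have := ho z zU.
rewrite /flux (big_setD1 e2 e2g) /= !(big_setD1 e1 e1g') /=.
set X := \sum_(_ in _) _; set Y := \sum_(_ in _) _; have {Y}-> : Y = X.
  apply: eq_bigr => e; rewrite !inE /arc_tail /arc_head /=.
  by move=> /andP[/negPf -> /andP[/negPf -> _]].
rewrite /arc_tail /arc_head /= !eqxx eq_sym (negPf ne) !inE.
by move: t1 h1 t2 h2; case: b1; case: b2 => -> -> -> ->; case: (o e1) => /=; lia.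
Qed.

(** The effect of joining two edges at x, with other ends y1 and y2 where one of
    them may be the outer vertex, into a single edge y1 y2. A set A avoiding x
    loses degree only if it contains y1 and y2, and then x |: A keeps its
    degree; x |: A loses degree only if it contains neither. The invariant
    p x + q x <= cut allows to pair each outer arc at x with an inner one. *)
Definition detaches U x g S p q g' S' p' q' : Prop :=
  [/\ [/\ arcs_within g' U, (#|arcs g'| <= #|arcs g|)%N
        & solvable g' U S' -> solvable g U S],
      (deg g' p' q' [set x] + 2 = deg g p q [set x])%N
        /\ (p' x + q' x <= cut g' [set x])%N,
      deg g' p' q' U = deg g p q U /\ demand S' U = demand S U,
      forall A, bnd S' p' q' A = bnd S p q A
    & forall A, A \subset U -> x \notin A ->
      [/\ deg g p q A = deg g' p' q' A \/ deg g p q A = (deg g' p' q' A + 2)%N,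
          deg g p q (x |: A) = deg g' p' q' (x |: A) \/
          deg g p q (x |: A) = (deg g' p' q' (x |: A) + 2)%N
        & deg g p q A = deg g' p' q' A \/
          deg g p q (x |: A) = deg g' p' q' (x |: A)]].

Lemma exists_detachment g U S p q x :
  arcs_within g U -> x \in U -> (2 <= deg g p q [set x])%N ->
  (p x + q x <= cut g [set x])%N ->
  exists g' S' p' q', detaches U x g S p q g' S' p' q'.
Proof.
move=> gU xU d2 wx.
have wgt1 r := weight_set1 r x.
have cut_pos : (0 < cut g [set x])%N.
  by move: d2; rewrite /deg !wgt1; lia.
have [e [y [eg exy xy]]] := cut_gt0 cut_pos.
have [_ yU] := joins_within gU eg exy xy.
have cutE A := cut_delete A eg exy.
have dW := arcs_within_delete (e := e) gU.
have dC : (#|arcs (delete g e)| <= #|arcs g|)%N by rewrite subset_leq_card ?subsetDl.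
(* Pairing an arc from the outer vertex to x with the edge xy amounts to fixing
   the latter as x -> y and moving the outer arc to y. *)
have [px|px] := ltnP 0 (p x).
  exists (delete g e), (shift S x y), (raise (lower p x) y 1), q.
  have pE A := weight_lower A px.
  split.
  - by split=> //; apply: solvable_delete.
  - have := cutE [set x]; rewrite /deg !wgt1 !inE eqxx eq_sym (negPf xy) /=.
    by rewrite /raise /lower eqxx (negPf xy); clear -px wx; lia.
  - rewrite /deg weight_raise demand_shift (pE U) (cutE U) xU yU.
    by clear; lia.
  - move=> A; rewrite /bnd weight_raise demand_shift (pE A).
    by clear; lia.
  - move=> A AU xA; rewrite /deg !weight_raise !pE !cutE !inE eqxx (negPf xA) /=.
    rewrite [y == x]eq_sym (negPf xy) /=.
    by case: (y \in A); clear; split; lia.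
have [qx|qx] := ltnP 0 (q x).
  exists (delete g e), (shift S y x), p, (raise (lower q x) y 1).
  have qE A := weight_lower A qx.
  split.
  - by split=> //; apply: solvable_delete => //; rewrite joinsC.
  - have := cutE [set x]; rewrite /deg !wgt1 !inE eqxx eq_sym (negPf xy) /=.
    by rewrite /raise /lower eqxx (negPf xy); clear -qx wx; lia.
  - rewrite /deg weight_raise demand_shift (qE U) (cutE U) xU yU.
    by clear; lia.
  - move=> A; rewrite /bnd weight_raise demand_shift (qE A).
    by clear; lia.
  - move=> A AU xA; rewrite /deg !weight_raise !qE !cutE !inE eqxx (negPf xA) /=.
    rewrite [y == x]eq_sym (negPf xy) /=.
    by case: (y \in A); clear; split; lia.
have cut_pos' : (0 < cut (delete g e) [set x])%N.
  have := cutE [set x]; rewrite !inE eqxx eq_sym (negPf xy) /=.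
  by move: d2 px qx; rewrite /deg !wgt1; clear; lia.
have [e2 [y2 [e2g' e2xy xy2]]] := cut_gt0 cut_pos'.
have e2g : e2 \in arcs g by move: e2g'; rewrite inE => /andP[].
have ne : e != e2 by move: e2g'; rewrite !inE eq_sym => /andP[].
have [_ y2U] := joins_within dW e2g' e2xy xy2.
have {}cutE A := cut_lift_pair A eg e2g ne exy e2xy.
exists (lift_pair g e e2 y y2), S, p, q; split.
- split.
  + move=> f; rewrite !inE /= => /andP[_ fg].
    by have [_ _|_] := eqVneq f e; [rewrite yU | apply: gU].
  + by rewrite /= subset_leq_card ?subsetDl.
  + exact: (solvable_lift_pair eg e2g ne exy e2xy).
- have := cutE [set x]; rewrite /deg !wgt1 !inE eqxx ![_ == x]eq_sym.
  rewrite (negPf xy) (negPf xy2) /=.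
  by move: px qx; clear; lia.
- have := cutE U; rewrite /deg xU yU y2U /=.
  by clear; lia.
- by [].
- move=> A AU xA; have := cutE A; have := cutE (x |: A).
  rewrite /deg !inE eqxx (negPf xA) ![_ == x]eq_sym (negPf xy) (negPf xy2) /=.
  by case: (y \in A); case: (y2 \in A); clear; split; lia.
Qed.

(** Pairing off the four edges arbitrarily preserves validity: when x has become
    isolated, A and x |: A have the same degree, and the accounting of detaches
    shows that this degree is that of A, that of x |: A, or two less than
    that of x |: A, where x |: A has slack and the same boundary as A. *)
Lemma remove_vertex_solvable g U S p q x :
  valid g U S p q -> no_small_set g U S p q -> (1 < #|U|)%N -> x \in U ->
  deg g p q [set x] = 4%N -> (3 %| bnd S p q [set x])%Z ->
  smaller_solvable (#|U| + #|arcs g|) -> solvable g U S.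
Proof.
move=> [gU SU gd sm] ns U1 xU dx bx IH.
have wgt1 r := weight_set1 r x.
have cutU g' : arcs_within g' U -> cut g' U = 0%N by apply: cut_full.
have Ux A : A != set0 -> A \proper U :\ x ->
    [/\ A \subset U, x \notin A, A \proper U, x |: A \proper U
      & (1 < #|x |: A|)%N].
  move=> A0 AUx; have AUx' := proper_sub AUx.
  have xA : x \notin A by apply/negP => /(subsetP AUx'); rewrite setD11.
  have AU : A \subset U by apply: subset_trans AUx' (subsetDl _ _).
  have cA := proper_card AUx; have cU := cardsD1 x U; rewrite xU in cU.
  have cxA : #|x |: A| = #|A|.+1 by rewrite cardsU1 xA.
  split=> //.
  - by rewrite properEcard AU; lia.
  - by rewrite properEcard subUset sub1set xU AU cxA; lia.
  - by rewrite cxA ltnS card_gt0.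
have x1U : [set x] \subset U by rewrite sub1set.
have bndD S' p' q' := bnd_setD S' p' q' x1U.
have wgtD r : weight r U = (r x + weight r (U :\ x))%N.
  by rewrite (weight_setD r x1U) wgt1.
(* Otherwise the complement of x in U would have too small a degree. *)
have wx : (p x + q x <= cut g [set x])%N.
  have : good (deg g p q (U :\ x)) (bnd S p q (U :\ x)).
    apply: gd; last exact: properD1.
    by rewrite -card_gt0; have := cardsD1 x U; rewrite xU; move: U1; clear; lia.
  move: sm dx; rewrite bndD /deg !wgtD !wgt1 cut_setD // cutU //; move: bx.
  by rewrite /good /small; clear; lia.
have [|g1 [S1 [p1 [q1 [[gU1 c1 s1] [d1 w1] [dU1 SU1] b1 A1]]]]] :=
  exists_detachment S gU xU _ wx.
  by rewrite dx.
have [|g2 [S2 [p2 [q2 [[gU2 c2 s2] [d2 w2] [dU2 SU2] b2 A2]]]]] :=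
  exists_detachment S1 gU1 xU _ w1.
  by move: d1; rewrite dx; clear; lia.
have {}d2 : deg g2 p2 q2 [set x] = 0%N by move: d1 d2; rewrite dx; clear; lia.
have [cx px qx] : [/\ cut g2 [set x] = 0%N, p2 x = 0%N & q2 x = 0%N].
  by move: d2; rewrite /deg !wgt1; clear; split; lia.
have Sx : (3 %| S2 x)%Z.
  move: bx; rewrite -b1 -b2 /bnd !wgt1 px qx demand_set1.
  by rewrite subr0 addr0.
apply/s1/s2.
have loop_x e : e \in arcs g2 -> (src g2 e == x) = (tgt g2 e == x).
  move=> eg; case: eqVneq => sx; case: eqVneq => tx //;
    suff: (0 < cut g2 [set x])%N by rewrite cx.
    by rewrite /cut (bigD1 e) //= /crosses !inE sx (negPf tx) eqxx.
  by rewrite /cut (bigD1 e) //= /crosses !inE tx (negPf sx) eqxx.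
have demD S' : demand S' U = S' x + demand S' (U :\ x).
  by rewrite (demand_setD S' x1U) demand_set1.
have [||o ho] := IH g2 (U :\ x) S2 p2 q2.
- by have := cardsD1 x U; rewrite xU; move: c1 c2; clear; lia.
- split.
  + move=> e eg ne; have /andP[sU tU] := gU2 e eg ne; rewrite !inE sU tU !andbT.
    have := loop_x e eg; have [sx|_ tx] := eqVneq (src g2 e) x.
      by move/esym/eqP => tx; rewrite sx tx eqxx in ne.
    by rewrite -tx.
  + by move: SU; rewrite -SU1 -SU2 demD; move: Sx; clear; lia.
  + move=> A A0 AUx; have [AU xA pA pxA cxA] := Ux A A0 AUx.
    have := A1 A AU xA; have := A2 A AU xA.
    have -> : deg g2 p2 q2 (x |: A) = deg g2 p2 q2 A.
      rewrite /deg /weight !big_setU1 //= px qx; congr (_ + _ + _)%N.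
      apply: eq_bigr => e eg; rewrite /crosses !inE.
      have := loop_x e eg.
      have [->|_] := eqVneq (src g2 e) x => [/esym/eqP ->|<- //].
      by rewrite eqxx addbb (negPf xA).
    have := gd A A0 pA; have := ns _ pxA cxA; have := gd _ _ pxA.
    have -> : bnd S2 p2 q2 A = bnd S p q A by rewrite b2 b1.
    have -> : bnd S p q (x |: A) = bnd S p q [set x] + bnd S p q A.
      by rewrite (bnd_setD S p q (subsetUl [set x] A)) setU1K.
    have -> : x |: A != set0 by apply/set0Pn; exists x; rewrite setU11.
    move=> /(_ isT); move: bx; clear; rewrite /good /small.
    by move=> ? ? ? ? [? ? ?] [? ? ?]; lia.
  + have -> : deg g2 p2 q2 (U :\ x) = deg g p q U.
      by rewrite -dU1 -dU2 /deg !wgtD px qx cut_setD // cx cutU.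
    have := bndD S2 p2 q2; rewrite !b2 !b1 => bU.
    by move: sm bx; rewrite bU /small; clear; lia.
exists o => z zU; have [->|zx] := eqVneq z x; last by apply: ho; rewrite !inE zx.
rewrite /flux big1 ?sub0r ?rpredN // => e eg; rewrite arc_tailE arc_headE !inE.
by rewrite loop_x //; case: (o e); rewrite subrr.
Qed.

(** * Solvability of valid instances *)

Lemma set1_neq0 (x : V) : [set x] != set0.
Proof. by apply/set0Pn; exists x; rewrite set11. Qed.

(** If no arc left A, the degrees of A and U :\: A, at least 4 each, would add
    up to the degree of the outer vertex, which is at most 7. *)
Lemma cut_proper_gt0 g U S p q A :
  valid g U S p q -> A != set0 -> A \proper U -> (0 < cut g A)%N.
Proof.
move=> [gU SU gd sm] A0 AU; have sAU := proper_sub AU.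
rewrite lt0n; apply/eqP => cA.
have dU : deg g p q U = (deg g p q A + deg g p q (U :\: A))%N.
  by rewrite /deg cut_setD // cA (cut_full gU) !(weight_setD _ sAU); clear; lia.
have A'0 : U :\: A != set0 by rewrite setD_eq0 proper_subn.
have A'U : U :\: A \proper U.
  rewrite properEcard subsetDl cardsD (setIidPr sAU).
  by move: A0 (subset_leq_card sAU); rewrite -card_gt0; clear; lia.
move: sm (gd A A0 AU) (gd _ A'0 A'U); rewrite dU /small /good; clear; lia.
Qed.

Lemma demand_opp S A : demand (fun x => - S x) A = - demand S A.
Proof. by rewrite /demand sumrN. Qed.

Lemma bnd_opp S p q A : bnd (fun x => - S x) q p A = - bnd S p q A.
Proof. by rewrite /bnd demand_opp; clear; lia. Qed.

Lemma deg_swap g p q A : deg g q p A = deg g p q A.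
Proof. by rewrite /deg addnAC. Qed.

(** Reversing every arc negates all boundaries, which halves the sign analysis
    in the final induction. *)
Lemma valid_opp g U S p q : valid g U S p q -> valid g U (fun x => - S x) q p.
Proof.
move=> [gU SU gd sm].
split=> //.
- by rewrite demand_opp rpredN.
- by move=> A A0 AU; rewrite deg_swap bnd_opp /good rpredN; apply: gd.
- by rewrite deg_swap bnd_opp /small rpredN.
Qed.

Lemma solvable_opp g U S : solvable g U (fun x => - S x) -> solvable g U S.
Proof.
move=> [o ho]; exists (fun e => ~~ o e) => x xU; have := ho x xU.
have -> : flux g (fun e => ~~ o e) [set x] = - flux g o [set x].
  rewrite /flux -sumrN; apply: eq_bigr => e _.
  by rewrite opprB !arc_tailE !arc_headE; case: (o e).
by move: (flux _ _ _) (S x); clear; lia.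
Qed.

Lemma valid_lower g U S p q x :
  valid g U S p q -> no_small_set g U S p q -> x \in U -> (0 < q x)%N ->
  out_ok (deg g p q [set x]) (bnd S p q [set x]) ->
  valid g U S p (lower q x).
Proof.
move=> [gU SU gd sm] ns xU qx xo; have qE A := weight_lower A qx.
split=> //.
- move=> A A0 AU; have := gd A A0 AU.
  have [[z zU Az]|A1] := proper_set1_or_large A0 AU; last first.
    move=> _; apply: (good_delete (ns A AU A1)); rewrite /deg /bnd (qE A).
    by case: (x \in A) => /=; clear; lia.
  move: xo; rewrite Az /out_ok /deg /bnd !qE !inE eqxx.
  have [->|xz] := eqVneq z x; first by rewrite /good; clear => /=; lia.
  by rewrite addn0.
- by move: sm; rewrite /deg /bnd (qE U) xU /small; clear; lia.
Qed.

(** A vertex x that tolerates leaving arcs but no entering arc has degree 5 and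
    tau = 1, or degree 6 and tau = 2. Changing its outer arcs so that its
    boundary moves by 3 and its degree grows makes an entering arc harmless,
    and the arc from y to x can be deleted at once. Larger sets have slack,
    hence degree at least 6; those containing x lose no degree, so they stay
    good whatever their new boundary is. *)
Lemma reversal_solvable g U S p q p' q' k x y e :
  valid g U S p q -> no_small_set g U S p q -> (1 < #|U|)%N ->
  e \in arcs g -> joins g y x e -> y != x ->
  out_ok (deg g p q [set y]) (bnd S p q [set y]) ->
  out_ok (deg g p q [set x]) (bnd S p q [set x]) ->
  ~~ in_ok (deg g p q [set x]) (bnd S p q [set x]) ->
  (0 < k)%N ->
  (forall A, weight p' A + weight q' A
             = weight p A + weight q A + k * (x \in A))%N ->
  (forall A, weight q' A + weight p A
             = weight q A + weight p' A + 3 * (x \in A))%N ->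
  small (weight p U + weight q U + k) (bnd S p q U) ->
  smaller_solvable (#|U| + #|arcs g|) -> solvable g U S.
Proof.
move=> [gU SU gd sm] ns U1 eg exy yx yo xo xi k0 hsum hdiff smk IH.
have [yU xU] := joins_within gU eg exy yx.
apply: (solvable_delete eg exy); apply: (IH _ _ _ p' q').
  by rewrite /= [in leqRHS](cardsD1 e) eg; clear; lia.
have cutE A := cut_delete A eg exy.
have degE A : deg (delete g e) p' q' A + ((y \in A) (+) (x \in A))
    = (deg g p q A + k * (x \in A))%N.
  by have := hsum A; rewrite /deg (cutE A); clear; lia.
have bndE A : bnd (shift S y x) p' q' A
    = bnd S p q A + 4 * (x \in A)%:Z - (y \in A)%:Z.
  by have := hdiff A; rewrite /bnd demand_shift; clear; lia.
split.
- exact: arcs_within_delete.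
- by rewrite demand_shift xU yU; move: SU; clear; lia.
- move=> A A0 AU; have := degE A; rewrite bndE.
  have [[z zU Az]|A1] := proper_set1_or_large A0 AU; last first.
    move: (ns A AU A1); move: (deg _ _ _ A) (deg _ _ _ A) (bnd _ _ _ A) k0.
    by rewrite /small /good; case: (x \in A); case: (y \in A); clear => /=; lia.
  have := gd A A0 AU; rewrite Az !inE.
  have [<-|yz] := eqVneq y z.
    rewrite eq_sym (negPf yx) /=; move: yo; rewrite /out_ok /good.
    move: (deg _ _ _ _) (deg _ _ _ _) (bnd _ _ _ _); clear; lia.
  have [<-|xz] := eqVneq x z.
    move: xo xi k0; rewrite /out_ok /in_ok /good.
    move: (deg _ _ _ _) (deg _ _ _ _) (bnd _ _ _ _); clear => /=; lia.
  rewrite /good; move: (deg _ _ _ _) (deg _ _ _ _) (bnd _ _ _ _); clear => /=; lia.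
- move: smk (degE U); rewrite bndE xU yU /deg (cut_full gU) /small.
  move: (cut _ _ + _ + _)%N (bnd _ _ _ _) => ? ?.
  by clear => /=; lia.
Qed.

Lemma weight_gt0 p U : (0 < weight p U)%N -> exists2 x, x \in U & (0 < p x)%N.
Proof.
rewrite lt0n sum_nat_eq0 negb_forall => /existsP[x].
by rewrite negb_imply -lt0n => /andP[xU px]; exists x.
Qed.

(** Here d outer arcs, all directed to U, have boundary -d; being small then
    forces d <= 5. The outer arc to x is traded for two opposite arcs or, if
    d = 0, three arcs from x to the outer vertex, whose total boundary is 0
    modulo 3, are added. *)
Lemma all_out_solvable g U S p q :
  valid g U S p q -> no_small_set g U S p q -> (1 < #|U|)%N ->
  (forall x, x \in U -> out_ok (deg g p q [set x]) (bnd S p q [set x])) ->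
  (forall x, x \in U -> ~~ in_ok (deg g p q [set x]) (bnd S p q [set x])) ->
  (forall S p' q', (weight p' U + weight q' U < weight p U + weight q U)%N ->
    valid g U S p' q' -> solvable g U S) ->
  smaller_solvable (#|U| + #|arcs g|) -> solvable g U S.
Proof.
move=> gv ns U1 outs ins IHw IH; have [gU SU gd sm] := gv.
have [q0|/weight_gt0[x xU qx]] := posnP (weight q U); last first.
  apply: (IHw S p (lower q x)); last exact: valid_lower (outs x xU).
  by rewrite (weight_lower U qx) xU; clear; lia.
have nbr x : x \in U ->
    exists e y, [/\ e \in arcs g, joins g y x e, y != x & y \in U].
  move=> xU; have := cut_proper_gt0 gv (set1_neq0 x) (set1_proper xU U1).
  move=> /cut_gt0[e [y [eg exy xy]]]; have [_ yU] := joins_within gU eg exy xy.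
  by exists e, y; rewrite joinsC eq_sym.
have p5 : (weight p U <= 5)%N.
  move: sm SU; rewrite /deg /bnd q0 (cut_full gU) /small.
  by move: (demand S U) (weight p U); clear; lia.
have [p0|/weight_gt0[x xU px]] := posnP (weight p U); last first.
  have [e [y [eg exy yx yU]]] := nbr x xU.
  apply: (@reversal_solvable g U S p q (lower p x) (raise q x 2) 1 x y e) => //.
  - exact: outs.
  - exact: outs.
  - exact: ins.
  - by move=> A; rewrite weight_raise (weight_lower A px); clear; lia.
  - by move=> A; rewrite weight_raise (weight_lower A px); clear; lia.
  - move: SU p5; rewrite /bnd q0 /small.
    by move: (demand S U) (weight p U); clear; lia.
have /card_gt0P[x xU] : (0 < #|U|)%N by apply: ltnW.
have [e [y [eg exy yx yU]]] := nbr x xU.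
apply: (@reversal_solvable g U S p q p (raise q x 3) 3 x y e) => //.
- exact: outs.
- exact: outs.
- exact: ins.
- by move=> A; rewrite weight_raise; clear; lia.
- by move=> A; rewrite weight_raise; clear; lia.
- by rewrite p0 q0.
Qed.

(** The main induction is on the number of vertices and arcs of g, so that the
    steps reducing it may choose new outer arcs freely. Dropping an outer arc
    changes neither, which is why an inner induction counts the outer arcs. *)
Theorem valid_solvable g U S p q : valid g U S p q -> solvable g U S.
Proof.
have [n] := ubnP (#|U| + #|arcs g|); elim: n g U S p q => // n IHn g U S p q.
rewrite ltnS => le_n.
have IH : smaller_solvable (#|U| + #|arcs g|).
  by move=> g' U' S' p' q' lt'; apply: IHn; apply: leq_trans lt' le_n.
have [m] := ubnP (weight p U + weight q U); elim: m S p q => // m IHm S p q.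
rewrite ltnS => le_m gv; have [gU SU gd sm] := gv.
have [U1|U1] := leqP #|U| 1.
  exists (fun=> true) => x xU.
  have Ux : U = [set x].
    by apply/eqP; rewrite eq_sym eqEcard sub1set xU cards1.
  rewrite /flux big1 ?sub0r ?rpredN; first by rewrite -(demand_set1 S) -Ux.
  move=> e eg; rewrite !arc_tailE !arc_headE.
  have [->|ne] := eqVneq (src g e) (tgt g e); first by rewrite subrr.
  by have := gU e eg ne; rewrite -Ux => /andP[-> ->].
have [/existsP[A /and3P[AU A1 smA]]|ns] := boolP [exists A : {set V},
    [&& A \proper U, 1 < #|A| & small (deg g p q A) (bnd S p q A)]]%N.
  exact: small_set_solvable gv AU A1 smA IH.
have {}ns : no_small_set g U S p q.
  move=> A AU A1; apply: contra ns => smA; apply/existsP; exists A.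
  by rewrite AU A1.
have [/existsP[x /and3P[xU /eqP dx bx]]|n4] := boolP [exists x,
    [&& x \in U, deg g p q [set x] == 4%N & (3 %| bnd S p q [set x])%Z]].
  exact: remove_vertex_solvable gv ns U1 xU dx bx IH.
pose out x := out_ok (deg g p q [set x]) (bnd S p q [set x]).
pose inn x := in_ok (deg g p q [set x]) (bnd S p q [set x]).
have out_or_in x : x \in U -> out x || inn x.
  move=> xU; have := gd _ (set1_neq0 x) (set1_proper xU U1).
  move: n4; rewrite negb_exists => /forallP/(_ x); rewrite xU /out /inn.
  move: (deg _ _ _ _) (bnd _ _ _ _); rewrite /out_ok /in_ok /good.
  by clear => /=; lia.
have [/existsP[e /existsP[x /existsP[y /and5P[eg exy xy xo yi]]]]|no_del] :=
  boolP [exists e, exists x, exists y,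
    [&& e \in arcs g, joins g x y e, x != y, out x & inn y]].
  exact: delete_arc_solvable gv ns eg exy xy xo yi IH.
have {}no_del e x y : e \in arcs g -> joins g x y e -> x != y -> out x ->
    ~~ inn y.
  move=> eg exy xy xo; apply: contra no_del => yi.
  apply/existsP; exists e; apply/existsP; exists x; apply/existsP; exists y.
  exact/and5P.
have one_sign x : x \in U -> ~~ (out x && inn x).
  move=> xU; have := cut_proper_gt0 gv (set1_neq0 x) (set1_proper xU U1).
  move=> /cut_gt0[e [y [eg exy xy]]]; have [_ yU] := joins_within gU eg exy xy.
  apply/negP => /andP[xo xi]; have /orP[yo|yi] := out_or_in y yU.
    by have := no_del e y x eg; rewrite joinsC eq_sym => /(_ exy xy yo); rewrite xi.
  by have := no_del e x y eg exy xy xo; rewrite yi.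
pose P := [set x in U | out x].
have sPU : P \subset U by apply/subsetP => x; rewrite inE => /andP[].
have [P0|P0] := eqVneq P set0.
  have noout x : x \in U -> ~~ out x.
    by move=> xU; apply/negP => xo; have := in_set0 x; rewrite -P0 inE xU xo.
  have okN d b : out_ok d (- b) = in_ok d b.
    by rewrite /out_ok /in_ok /good -opprD rpredN.
  have okN' d b : in_ok d (- b) = out_ok d b by rewrite -okN opprK.
  apply: solvable_opp; apply: (all_out_solvable (valid_opp gv)) => //.
  - by move=> A AU A1; rewrite deg_swap bnd_opp /small rpredN; apply: ns.
  - move=> x xU; rewrite deg_swap bnd_opp okN.
    by have := out_or_in x xU; rewrite (negPf (noout x xU)).
  - by move=> x xU; rewrite deg_swap bnd_opp okN'; apply: noout.
  - by move=> S' p' q' lt; apply: IHm; move: lt le_m; clear; lia.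
have PU : P = U.
  apply/eqP; rewrite eqEsubset sPU; apply/negPn/negP => nPU.
  have := cut_proper_gt0 gv P0; rewrite properE sPU nPU => /(_ isT).
  rewrite lt0n sum_nat_eq0 negb_forall => /existsP[e].
  rewrite negb_imply eqb0 negbK => /andP[eg].
  have [s|ne] := eqVneq (src g e) (tgt g e); first by rewrite /crosses s addbb.
  have /andP[sU tU] := gU e eg ne.
  rewrite /crosses !inE sU tU /=.
  have [so|so] := boolP (out (src g e)).
    have := no_del e _ (tgt g e) eg _ ne so; have := out_or_in _ tU.
    by rewrite /joins !eqxx => /orP[->//|->] /(_ isT).
  rewrite /= => to; have := no_del e (tgt g e) (src g e) eg.
  have := out_or_in _ sU.
  by rewrite /joins !eqxx orbT (negPf so) [tgt g e == _]eq_sym /= => -> /(_ isT ne to).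
have outs x : x \in U -> out x by rewrite -{1}PU inE => /andP[].
apply: (all_out_solvable gv) => //.
- by move=> x xU; have := one_sign x xU; rewrite (outs x xU).
- by move=> S' p' q' lt; apply: IHm; apply: leq_trans lt le_m.
Qed.

End Extension.

(** * Vertex sets meeting both sides of every small cut *)

Section SeparatingSets.

Variable V : finType.

Definition separates (T X : {set V}) : bool :=
  (T :&: X != set0) && (T :\: X != set0).

Lemma separatesI (T X : {set V}) (u v : V) :
  u \in T -> v \in T -> u \in X -> v \notin X -> separates T X.
Proof.
by move=> uT vT uX vX; apply/andP; split; apply/set0Pn;
  [exists u | exists v]; rewrite !inE ?uT ?vT ?andbT.
Qed.

(** Two vertices in opposite quadrants of the bipartitions given by X and Y
    separate both. Some pair of opposite quadrants is nonempty, since two empty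
    quadrants that are not opposite would make X or Y trivial. *)
Lemma separates2 (X Y : {set V}) : separates setT X -> separates setT Y ->
  exists u v, separates [set u; v] X && separates [set u; v] Y.
Proof.
move=> /andP[/set0Pn[a aX] /set0Pn[b bX]] /andP[/set0Pn[c cY] /set0Pn[d dY]].
move: aX bX cY dY; rewrite !inE /= !andbT => aX bX cY dY.
have sep u v : (u \in X) != (v \in X) -> (u \in Y) != (v \in Y) ->
    exists u v, separates [set u; v] X && separates [set u; v] Y.
  move=> uvX uvY; exists u, v.
  have h (Z : {set V}) : (u \in Z) != (v \in Z) -> separates [set u; v] Z.
    case uZ: (u \in Z); case vZ: (v \in Z) => // _.
      by apply: (@separatesI _ _ u v); rewrite ?inE ?eqxx ?orbT ?uZ ?vZ.
    by apply: (@separatesI _ _ v u); rewrite ?inE ?eqxx ?orbT ?uZ ?vZ.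
  by rewrite !h.
case aY: (a \in Y); case bY: (b \in Y).
- case dX: (d \in X).
    by apply: (sep b d); rewrite ?(negPf bX) ?dX ?bY ?(negPf dY).
  by apply: (sep a d); rewrite ?aX ?dX ?aY ?(negPf dY).
- by apply: (sep a b); rewrite ?aX ?(negPf bX) ?aY ?bY.
- by apply: (sep a b); rewrite ?aX ?(negPf bX) ?aY ?bY.
- case cX: (c \in X).
    by apply: (sep b c); rewrite ?(negPf bX) ?cX ?bY ?cY.
  by apply: (sep a c); rewrite ?aX ?cX ?aY ?cY.
Qed.

Lemma separates_add (T X : {set V}) : T != set0 -> separates setT X ->
  exists2 t, separates (t |: T) X
    & forall Y, separates T Y -> separates (t |: T) Y.
Proof.
move=> /set0Pn[s sT] /andP[/set0Pn[a aX] /set0Pn[b bX]].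
move: aX bX; rewrite !inE /= andbT => aX bX.
have mono t Y : separates T Y -> separates (t |: T) Y.
  move=> /andP[/set0Pn[u /setIP[uT uY]] /set0Pn[v /setDP[vT vY]]].
  by apply: (@separatesI _ _ u v); rewrite // !inE ?uT ?vT orbT.
have [sX|sX] := boolP (s \in X).
  exists b; last exact: mono.
  by apply: (@separatesI _ _ s b); rewrite // !inE ?eqxx ?sT ?orbT.
exists a; last exact: mono.
by apply: (@separatesI _ _ a s); rewrite // !inE ?eqxx ?sT ?orbT.
Qed.

(** The first two sets share a pair of separating vertices; this saves the one
    vertex that makes five suffice for five cuts. *)
Lemma exists_separating (Xs : seq {set V}) :
  (forall X, X \in Xs -> separates setT X) ->
  exists2 T : {set V}, (#|T| <= maxn 2 (size Xs))%N
    & forall X, X \in Xs -> separates T X.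
Proof.
case: Xs => [|X Xs] sepXs; first by exists set0; rewrite ?cards0.
have sX : separates setT X by apply: sepXs; rewrite mem_head.
case: Xs sepXs => [|Y Xs] sepXs.
  have [u [v /andP[uvX _]]] := separates2 sX sX.
  exists [set u; v]; first by rewrite cards2; case: eqP.
  by move=> Z; rewrite inE => /eqP ->.
rewrite (maxn_idPr _) //; elim: Xs sepXs => [|Z Xs IH] sepXs.
  have sY : separates setT Y by apply: sepXs; rewrite !inE eqxx orbT.
  have [u [v /andP[uvX uvY]]] := separates2 sX sY.
  exists [set u; v]; first by rewrite cards2; case: eqP.
  by move=> W; rewrite !inE => /orP[] /eqP ->.
have [|T cT hT] := IH.
  move=> W; rewrite !inE => hW; apply: sepXs; rewrite !inE.
  by case/or3P: hW => ->; rewrite ?orbT.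
have T0 : T != set0.
  have /andP[+ _] := hT X (mem_head _ _).
  by apply: contraNneq => ->; rewrite set0I.
have sZ : separates setT Z by apply: sepXs; rewrite !inE eqxx !orbT.
have [t tZ tmono] := separates_add T0 sZ.
exists (t |: T).
  by rewrite cardsU1; move: cT => /=; case: (_ \notin _); lia.
move=> W; rewrite !inE => /or4P[] hW.
- by apply/tmono/hT; rewrite !inE hW.
- by apply/tmono/hT; rewrite !inE hW orbT.
- by rewrite (eqP hW).
- by apply/tmono/hT; rewrite !inE hW !orbT.
Qed.

End SeparatingSets.

Section Cuts.

Variable G : multigraph.

Implicit Types (A X : {set vert G}).

Lemma mem_edge_boundary (u v : vert G) (e : edge G) A :
  ends e = [set u; v] -> (e \in edge_boundary A) = (u \in A) (+) (v \in A).
Proof.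
move=> ee; rewrite inE; apply/idP/idP.
  case/existsP=> x /andP[xA /existsP[y /andP[]]]; rewrite inE => yA /eqP exy.
  have : x \in [set u; v] by rewrite -ee exy !inE eqxx.
  have : y \in [set u; v] by rewrite -ee exy !inE eqxx orbT.
  have : u \in [set x; y] by rewrite -exy ee !inE eqxx.
  have : v \in [set x; y] by rewrite -exy ee !inE eqxx orbT.
  rewrite !inE; case/orP=> /eqP ->; case/orP=> /eqP ->; rewrite ?xA ?(negPf yA) //.
    by rewrite !orbb => /eqP yx; rewrite yx xA in yA.
  by rewrite !orbb => _ /eqP xy; rewrite -xy xA in yA.
have [uA|uA] := boolP (u \in A) => /= vA.
  apply/existsP; exists u; rewrite uA; apply/existsP; exists v.
  by rewrite inE vA ee eqxx.
apply/existsP; exists v; rewrite vA; apply/existsP; exists u.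
by rewrite inE uA ee setUC eqxx.
Qed.

Lemma ends_pair (e : edge G) :
  exists uv : vert G * vert G, ends e = [set uv.1; uv.2].
Proof.
have /eqP/cards2P[u [v [_ ->]]] := card_ends e.
by exists (u, v).
Qed.

Lemma separates_proper A : A != set0 -> A \proper setT -> separates setT A.
Proof. by move=> A0 AT; rewrite /separates setTI A0 setD_eq0 proper_subn. Qed.

Lemma edge_boundary_ge k A : edge_connected k G -> separates setT A ->
  (k <= #|edge_boundary A|)%N.
Proof.
move=> conn /andP[/set0Pn[x /setIP[_ xA]] /set0Pn[y /setDP[_ yA]]].
rewrite leqNgt; apply/negP => lt.
have clA : closed (adjacent_avoiding (edge_boundary A)) A.
  move=> u v /existsP[e /andP[eA /eqP ee]].
  by move: eA; rewrite (mem_edge_boundary _ ee); case: (u \in A); case: (v \in A).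
by have := closed_connect clA (conn _ lt x y); rewrite xA (negPf yA).
Qed.

(** If two sets have the same boundary, no edge leaves their symmetric
    difference. *)
Lemma edge_boundary_inj A X : edge_connected 1 G ->
  edge_boundary A = edge_boundary X -> A = X \/ A = ~: X.
Proof.
move=> conn eAX; pose Z := [set x | (x \in A) (+) (x \in X)].
have Zb : edge_boundary Z = set0.
  apply/setP => e; have [[u v] /= ee] := ends_pair e.
  have := congr1 (fun B : {set edge G} => e \in B) eAX.
  rewrite /= !(mem_edge_boundary _ ee) !inE.
  by case: (u \in A); case: (u \in X); case: (v \in A); case: (v \in X).
have [sZ|] := boolP (separates setT Z).
  by have := edge_boundary_ge conn sZ; rewrite Zb cards0.
rewrite /separates setTI negb_and !negbK => /orP[/eqP Z0|ZT]; [left|right].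
  apply/setP => x; have := in_set0 x; rewrite -Z0 inE.
  by case: (x \in A); case: (x \in X).
apply/setP => x; move: ZT; rewrite setD_eq0 => /subsetP/(_ x (in_setT x)).
by rewrite !inE; case: (x \in A); case: (x \in X).
Qed.

Lemma exists_cut_separator k : edge_connected 1 G -> (0 < k)%N ->
  exists2 T : {set vert G}, (#|T| <= maxn 2 #|edge_cuts k G|)%N
    & forall A, #|edge_boundary A| = k -> T :&: A != set0.
Proof.
move=> conn k0.
pose side (C : {set edge G}) :=
  odflt set0 [pick X : {set vert G} | C == edge_boundary X].
have sideP C : C \in edge_cuts k G -> edge_boundary (side C) = C /\ #|C| = k.
  rewrite inE => /andP[/eqP cC /existsP[X CX]]; split=> //.
  by rewrite /side; case: pickP => [Y /eqP ->//|/(_ X)]; rewrite CX.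
have [|T cT hT] := @exists_separating _ [seq side C | C <- enum (edge_cuts k G)].
  move=> X /mapP[C]; rewrite mem_enum => /sideP[sC cC] ->.
  have : (0 < #|edge_boundary (side C)|)%N by rewrite sC cC.
  apply: contraTT; rewrite -leqNgt leqn0 cards_eq0.
  rewrite /separates setTI negb_and !negbK setD_eq0 subTset.
  by case/orP=> /eqP ->; apply/eqP/setP => e; have [[u v] ee] := ends_pair e;
    rewrite (mem_edge_boundary _ ee) !inE.
exists T; first by rewrite size_map -cardE in cT.
move=> A cA; have AC : edge_boundary A \in edge_cuts k G.
  by rewrite inE cA eqxx; apply/existsP; exists A.
have /hT : side (edge_boundary A) \in [seq side C | C <- enum (edge_cuts k G)].
  by rewrite map_f ?mem_enum.
have [sA _] := sideP _ AC; move: (side _) sA => X sA /andP[TX TX'].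
have [->|->] := edge_boundary_inj conn (esym sA); first by [].
by rewrite -setDE.
Qed.

End Cuts.

(** * The theorem *)

Lemma intr_Z3_eq0 (z : int) : (z%:~R == 0 :> 'Z_3) = (3 %| z)%Z.
Proof.
have natZ n : (n%:R == 0 :> 'Z_3) = (3 %| n)%N.
  by rewrite -val_eqE /= val_Zp_nat.
by case: z => n; rewrite ?NegzE ?rmorphN ?oppr_eq0 /= natZ ?rpredN.
Qed.

Theorem theorem1p17 (G : multigraph)
  (hconn : edge_connected 5 G)
  (hcuts : (#|edge_cuts 5 G| <= 5)%N) :
  Z3_connected G.
Proof.
move=> beta beta0.
have conn1 : edge_connected 1 G by move=> S S1; apply: hconn; apply: leq_trans S1 _.
have [T cT hT] := exists_cut_separator conn1 (isT : (0 < 5)%N).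
have {}cT : (#|T| <= 5)%N by apply: leq_trans cT _; rewrite geq_max hcuts.
have [f fP] := fin_all_exists (@ends_pair G).
pose g := Digraph setT (fst \o f) (snd \o f).
pose S (v : vert G) : int := (beta v : nat)%:Z.
pose p (v : vert G) : nat := v \in T.
have SE v : (S v)%:~R = beta v by rewrite /S -pmulrn natr_Zp.
have cutE A : cut g A = #|edge_boundary A|.
  rewrite /cut -sum1_card [LHS]big_mkcond [RHS]big_mkcond /=; apply: eq_bigr => e _.
  by rewrite in_setT (mem_edge_boundary _ (fP e)) /crosses /=; case: (_ (+) _).
have weightE A : weight p A = #|T :&: A|.
  rewrite /weight /p -sum1_card -big_mkcondr; apply: eq_bigl => v.
  by rewrite inE andbC.
have [|o ho] := @valid_solvable _ _ g setT S p (fun=> 0%N).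
  split.
  - by move=> e; rewrite !inE.
  - rewrite -intr_Z3_eq0 /demand rmorph_sum /=; apply/eqP.
    rewrite -[RHS](beta0 : \sum_v beta v = 0).
    by apply: eq_big => [v|v _]; rewrite ?inE // SE.
  - move=> A A0 AT; have := edge_boundary_ge hconn (separates_proper A0 AT).
    have := hT A; rewrite -cutE /deg weightE /good -card_gt0.
    by move: (cut g A) #|_ :&: _| (weight _ _) (bnd _ _ _ _) => c t w b; lia.
  - rewrite /small /deg cut_full; last by move=> e; rewrite !inE.
    rewrite weightE setIT /weight big1 // addn0 add0n ltnS cT.
    by [].
have orient e : ends e = [set arc_tail g o e; arc_head g o e].
  by rewrite fP /arc_tail /arc_head /=; case: (o e); rewrite // setUC.
(* An arc of value 2 is a reversed arc of value 1, so as the orientation is free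
   the constant value 1 suffices. *)
exists (Orientation orient), (fun=> 1); split=> [//|v].
have := ho v (in_setT v); rewrite -intr_Z3_eq0 rmorphB /= subr_eq0 SE => /eqP <-.
have count_set (B : {set edge G}) :
    \sum_(e in B) (1 : 'Z_3) = \sum_e (e \in B)%:R.
  by rewrite big_mkcond; apply: eq_bigr => e _; case: (e \in B).
rewrite !count_set /flux rmorph_sum /= [RHS]big_mkcond -sumrB.
by apply: eq_bigr => e _; rewrite in_setT rmorphB /= !inE; do 2![case: (_ == v)].
Qed.
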